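(* Let $R$ be a semilocal ring. Then the ring $R$ is a weakly left localizable ring with $\mathrm{rad}(R)=\mathcal{N}_R$ if and only if $R\simeq\prod_{i=1}^s R_i$ (for some $s\ge1$) where the $R_i$ are local rings with $\mathrm{rad}(R_i)=\mathcal{N}_{R_i}$.
   Context: All rings are associative with $1\neq 0$; ideals are two-sided. For a ring $R$: $R^*$ is the group of units, $\mathrm{rad}(R)$ is the Jacobson radical, and $\mathcal{N}_R$ is the nil radical, i.e. the sum of all nil ideals of $R$. $R$ is local if $R\setminus R^*$ is an ideal of $R$ (equivalently, $R/\mathrm{rad}(R)$ is a division ring). $R$ is semilocal if $R/\mathrm{rad}(R)$ is a semisimple (Artinian) ring. A subset $S\subseteq R$ closed under multiplication with $1\in S$, $0\notin S$ is a left Ore set if $Sr\cap Rs\neq\emptyset$ for all $r\in R$, $s\in S$. A left Ore set $S$ is a left denominator set if $rs=0$ with $r\in R$, $s\in S$ implies $tr=0$ for some $t\in S$. An element of $R$ is left localizable if it belongs to some left denominator set of $R$. $R$ is weakly left localizable if every non-nilpotent element of $R$ is left localizable. *)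

(* Defs.v *)
From HB Require Import structures.
From mathcomp Require Import all_boot all_algebra.
From mathcomp Require Import boolp classical_sets.

Set Implicit Arguments.
Unset Strict Implicit.
Unset Printing Implicit Defensive.

Import GRing.Theory.
Local Open Scope ring_scope.
Local Open Scope classical_set_scope.

(* The notions below make sense for arbitrary unital rings (pzRingType), the
   zero ring included; rings with 1 != 0 are the nzRingType instances. *)

Section RingNotions.
Variable R : pzRingType.
Implicit Types (I J L M S : set R) (F : set (set R)) (r s x y : R).

Definition units : set R := [set x | exists y, y * x = 1 /\ x * y = 1].

Definition nilpotent x : Prop := exists n : nat, x ^+ n = 0.

Definition left_ideal I : Prop :=
  [/\ I 0, (forall x y, I x -> I y -> I (x + y))
    & forall a x, I x -> I (a * x)].

Definition two_sided_ideal I : Prop :=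
  left_ideal I /\ (forall a x, I x -> I (x * a)).

(* The sum of a possibly infinite family of ideals: all finite sums of
   elements taken from members of the family. *)
Definition ideal_sum F : set R :=
  [set x | exists s : seq R,
     (forall y, y \in s -> exists2 I, F I & I y) /\ x = \sum_(y <- s) y].

Definition maximal_left_ideal M : Prop :=
  [/\ left_ideal M, M <> setT
    & forall J, left_ideal J -> M `<=` J -> J = M \/ J = setT].

Definition jacobson : set R :=
  [set x | forall M, maximal_left_ideal M -> M x].

Definition nil_ideal I : Prop :=
  two_sided_ideal I /\ (forall x, I x -> nilpotent x).

Definition nil_radical : set R := ideal_sum nil_ideal.

(* Simple submodules of R as a left module over itself. *)
Definition minimal_left_ideal L : Prop :=
  [/\ left_ideal L, L <> [set 0]
    & forall J, left_ideal J -> J `<=` L -> J = [set 0] \/ J = L].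

(* R is a semisimple left module over itself, i.e. a sum of simple
   submodules; as R is unital, it is then automatically left Artinian. *)
Definition semisimple : Prop := ideal_sum minimal_left_ideal = setT.

Definition local : Prop := two_sided_ideal (~` units).

Definition left_ore_set S : Prop :=
  [/\ S 1, ~ S 0, (forall x y, S x -> S y -> S (x * y))
    & forall r s, S s -> exists t u, S t /\ t * r = u * s].

Definition left_denominator_set S : Prop :=
  left_ore_set S /\
  (forall r s, S s -> r * s = 0 -> exists2 t, S t & t * r = 0).

Definition left_localizable x : Prop :=
  exists2 S, left_denominator_set S & S x.

Definition weakly_left_localizable : Prop :=
  forall x, ~ nilpotent x -> left_localizable x.

Lemma left_idealN I x : left_ideal I -> I x -> I (- x).
Proof. by case=> _ _ IM Ix; rewrite -mulN1r; exact: IM. Qed.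

Lemma left_idealB I x y : left_ideal I -> I x -> I y -> I (x - y).
Proof. by move=> idI Ix Iy; case: (idI) => _ ID _; apply: ID => //; exact: left_idealN. Qed.

Lemma jacobson_left_ideal : left_ideal jacobson.
Proof.
split=> [M [[M0 _ _] _ _]|x y Jx Jy M maxM|a x Jx M maxM]; first exact: M0.
  by have [[_ MD _] _ _] := maxM; apply: MD; [exact: Jx|exact: Jy].
by have [[_ _ MM] _ _] := maxM; apply: MM; exact: Jx.
Qed.

Lemma jacobson_two_sided : two_sided_ideal jacobson.
Proof.
split; first exact: jacobson_left_ideal.
move=> a x Jx M maxM; apply: contrapT => nMxa.
have [idM _ maxlM] := maxM; have [M0 MD MM] := idM.
pose K : set R := [set y | M (y * a)].
suff /Jx : maximal_left_ideal K by [].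
have idK : left_ideal K.
  split; rewrite /K /=; first by rewrite mul0r.
    by move=> y z My Mz; rewrite mulrDl; exact: MD.
  by move=> b y My; rewrite -mulrA; exact: MM.
split=> //.
  by move=> KT; apply: nMxa; have : K x by rewrite KT.
move=> J [J0 JD JM] KJ.
(* [M + J a] is a left ideal containing [M] *)
pose N : set R := [set z | exists m j, [/\ M m, J j & z = m + j * a]].
have idN : left_ideal N.
  split=> [|_ _ [m [j [Mm Jj ->]]] [m' [j' [Mm' Jj' ->]]]|b _ [m [j [Mm Jj ->]]]].
  - by exists 0, 0; split=> //; rewrite mul0r addr0.
  - exists (m + m'), (j + j'); split; [exact: MD|exact: JD|].
    by rewrite mulrDl addrACA.
  - exists (b * m), (b * j); split; [exact: MM|exact: JM|].
    by rewrite mulrDr mulrA.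
have MN : M `<=` N by move=> m Mm; exists m, 0; rewrite mul0r addr0.
have [NM|NT] := maxlM _ idN MN; [left|right]; apply/seteqP; split=> // y.
  move=> Jy; rewrite /K /= -NM; exists 0, y; split=> //.
  by rewrite add0r.
move=> _; have [m [j [Mm Jj yaE]]] : N (y * a) by rewrite NT.
have Ky : K (y - j) by rewrite /K /= mulrBl yaE addrK.
by rewrite -[y](subrK j); apply: JD => //; exact: KJ.
Qed.

End RingNotions.

Arguments units R : clear implicits.
Arguments jacobson R : clear implicits.
Arguments nil_radical R : clear implicits.

(* The quotient ring R / I by a two-sided ideal; Quotient.quot supplies the
   additive group, and only for commutative rings the multiplication. *)
Section IdealQuotient.
Variables (R : pzRingType) (I : set R) (idI : two_sided_ideal I).

(* The (unused) argument idI lets canonical inference find idI. *)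
Definition ideal_pred of two_sided_ideal I : {pred R} := fun x => `[< I x >].

Fact ideal_pred_zmod_closed : zmod_closed (ideal_pred idI).
Proof.
have [lI _] := idI; split=> [|x y /asboolP Ix /asboolP Iy]; apply/asboolP.
  by case: lI.
exact: left_idealB.
Qed.

HB.instance Definition _ :=
  GRing.isZmodClosed.Build R (ideal_pred idI) ideal_pred_zmod_closed.

Definition ideal_quot : Type := Quotient.quot (ideal_pred idI).
HB.instance Definition _ := GRing.Zmodule.on ideal_quot.

Definition quot_pi (x : R) : ideal_quot :=
  (\pi_(Quotient.quot (ideal_pred idI)) x)%qT.
Definition quot_repr (q : ideal_quot) : R :=
  repr (q : Quotient.quot (ideal_pred idI)).

Lemma quot_reprK q : quot_pi (quot_repr q) = q.
Proof. exact: reprK. Qed.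

Lemma quot_piP x y : quot_pi x = quot_pi y <-> I (x - y).
Proof.
split=> [/eqP|Ixy].
  by rewrite -Quotient.idealrBE => /asboolP.
by apply/eqP; rewrite -Quotient.idealrBE; apply/asboolP.
Qed.

Lemma quot_piD x y : quot_pi (x + y) = quot_pi x + quot_pi y.
Proof. exact: (raddfD (\pi_(Quotient.quot (ideal_pred idI)))%qT). Qed.

Definition quot_one : ideal_quot := quot_pi 1.
Definition quot_mul (p q : ideal_quot) : ideal_quot :=
  quot_pi (quot_repr p * quot_repr q).

Lemma quot_piM x y : quot_pi (x * y) = quot_mul (quot_pi x) (quot_pi y).
Proof.
have [lI Ir] := idI; have [_ ID IM] := lI; apply/quot_piP.
set x' := quot_repr _; set y' := quot_repr _.
have Ix : I (x - x') by apply/quot_piP; rewrite quot_reprK.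
have Iy : I (y - y') by apply/quot_piP; rewrite quot_reprK.
have -> : x * y - x' * y' = (x - x') * y + x' * (y - y').
  by rewrite mulrBl mulrBr addrA subrK.
by apply: ID; [exact: Ir|exact: IM].
Qed.

Fact quot_mulA : associative quot_mul.
Proof.
move=> p q r; rewrite -[p]quot_reprK -[q]quot_reprK -[r]quot_reprK.
by rewrite -!quot_piM mulrA.
Qed.

Fact quot_mul1q : left_id quot_one quot_mul.
Proof. by move=> p; rewrite -[p]quot_reprK -quot_piM mul1r. Qed.

Fact quot_mulq1 : right_id quot_one quot_mul.
Proof. by move=> p; rewrite -[p]quot_reprK -quot_piM mulr1. Qed.

Fact quot_mulDl : left_distributive quot_mul +%R.
Proof.
move=> p q r; rewrite -[p]quot_reprK -[q]quot_reprK -[r]quot_reprK.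
by rewrite -quot_piD -!quot_piM -quot_piD mulrDl.
Qed.

Fact quot_mulDr : right_distributive quot_mul +%R.
Proof.
move=> p q r; rewrite -[p]quot_reprK -[q]quot_reprK -[r]quot_reprK.
by rewrite -quot_piD -!quot_piM -quot_piD mulrDr.
Qed.

HB.instance Definition _ := GRing.Zmodule_isPzRing.Build ideal_quot
  quot_mulA quot_mul1q quot_mulq1 quot_mulDl quot_mulDr.

End IdealQuotient.

Definition semilocal (R : pzRingType) : Prop :=
  semisimple (ideal_quot (jacobson_two_sided R)).

(* The direct product of a family of rings, with componentwise operations. *)
Section ProductRing.
Variables (I : Type) (R_ : I -> pzRingType).

Definition prod_ring : Type := forall i, R_ i.
HB.instance Definition _ := Choice.copy prod_ring (forall i, R_ i).

Implicit Types f g h : prod_ring.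

Definition prod_zero : prod_ring := fun=> 0.
Definition prod_one : prod_ring := fun=> 1.
Definition prod_opp f : prod_ring := fun i => - f i.
Definition prod_add f g : prod_ring := fun i => f i + g i.
Definition prod_mul f g : prod_ring := fun i => f i * g i.

Fact prod_addA : associative prod_add.
Proof. by move=> f g h; apply: functional_extensionality_dep => i; exact: addrA. Qed.
Fact prod_addC : commutative prod_add.
Proof. by move=> f g; apply: functional_extensionality_dep => i; exact: addrC. Qed.
Fact prod_add0 : left_id prod_zero prod_add.
Proof. by move=> f; apply: functional_extensionality_dep => i; exact: add0r. Qed.
Fact prod_addN : left_inverse prod_zero prod_opp prod_add.
Proof. by move=> f; apply: functional_extensionality_dep => i; exact: addNr. Qed.

HB.instance Definition _ :=
  GRing.isZmodule.Build prod_ring prod_addA prod_addC prod_add0 prod_addN.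

Fact prod_mulA : associative prod_mul.
Proof. by move=> f g h; apply: functional_extensionality_dep => i; exact: mulrA. Qed.
Fact prod_mul1f : left_id prod_one prod_mul.
Proof. by move=> f; apply: functional_extensionality_dep => i; exact: mul1r. Qed.
Fact prod_mulf1 : right_id prod_one prod_mul.
Proof. by move=> f; apply: functional_extensionality_dep => i; exact: mulr1. Qed.
Fact prod_mulDl : left_distributive prod_mul +%R.
Proof. by move=> f g h; apply: functional_extensionality_dep => i; exact: mulrDl. Qed.
Fact prod_mulDr : right_distributive prod_mul +%R.
Proof. by move=> f g h; apply: functional_extensionality_dep => i; exact: mulrDr. Qed.

HB.instance Definition _ := GRing.Zmodule_isPzRing.Build prod_ring
  prod_mulA prod_mul1f prod_mulf1 prod_mulDl prod_mulDr.

End ProductRing.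

Definition ring_isomorphic (A B : pzRingType) : Prop :=
  exists f : {rmorphism A -> B}, bijective f.

(* Main.v *)
(* For the forward implication put [J = rad R], a nil ideal, and let [L] be a
   left ideal minimal over [J]. Then [L = Re + J] with [e] idempotent modulo
   [J]; [e] lies in a left denominator set [S], whose torsion ideal
   [A = {r | t r = 0 for some t in S}] contains a power of [1 - e]. Hence
   [P = A + J] is a two-sided ideal that is maximal as a left ideal, it
   satisfies [P L <= J], and [R / A] is local with nil maximal ideal [P / A].
   As [R] is a finite sum of such [L] modulo [J], finitely many [P] occur; the
   ideals [A] chosen for distinct [P] are comaximal, and they intersect in [0]
   because the left annihilator of a common element lies in no [P]. The Chinese
   remainder theorem concludes, so that no idempotent has to be lifted.

   Conversely, a non-nilpotent element of the product has a unit component,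
   say the [i]-th, and the elements whose [i]-th component is a unit form a left
   denominator set. *)
From HB Require Import structures.
Require Import Defs.
From mathcomp Require Import all_boot all_algebra.
From mathcomp Require Import boolp classical_sets.

Set Implicit Arguments.
Unset Strict Implicit.
Unset Printing Implicit Defensive.

Import GRing.Theory.

(** * Nil ideals, the nil radical and the Jacobson radical *)

Section NilRadical.
Local Open Scope ring_scope.
Local Open Scope classical_set_scope.
Variable R : pzRingType.
Implicit Types (A I J K L M P S : set R) (e r s t x y : R).

Lemma subr1_nilpotent_linv x : nilpotent x -> exists u, u * (1 - x) = 1.
Proof.
move=> [n xn0]; exists (\sum_(i < n) x ^+ i).
have xC : GRing.comm (1 - x) (\sum_(i < n) x ^+ i).
  apply: commr_sum => i _; apply: commrX.
  by apply: commr_sym; apply: commrB; [exact: commr1|].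
by rewrite -xC -opprB mulNr -subrX1 xn0 sub0r opprK.
Qed.

(** By maximality the left ideal [M + R x], called [K] below, is all of [R] and so contains [1]. *)
Lemma maximal_left_ideal_linv M x : maximal_left_ideal M -> ~ M x ->
  exists r, M (1 - r * x).
Proof.
move=> [[M0 MD MM] _ maxM] nMx.
pose K : set R := [set z | exists r, M (z - r * x)].
have idK : left_ideal K.
  split=> [|z z' [r Mz] [r' Mz']|a z [r Mz]].
  - by exists 0; rewrite mul0r subr0.
  - by exists (r + r'); rewrite mulrDl opprD addrACA; exact: MD.
  - by exists (a * r); rewrite -mulrA -mulrBr; exact: MM.
have [|KM|KT] := maxM K idK.
- by move=> z Mz; exists 0; rewrite mul0r subr0.
- by case: nMx; rewrite -KM; exists 1; rewrite mul1r subrr.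
- by have : K 1 by rewrite KT.
Qed.

Lemma left_ideal1_nil M x : left_ideal M -> nilpotent x -> M (1 - x) -> M 1.
Proof.
by case=> _ _ MM /subr1_nilpotent_linv[u u1] M1x; rewrite -u1; exact: MM.
Qed.

Lemma maximal_left_ideal1 M : maximal_left_ideal M -> ~ M 1.
Proof.
move=> [[_ _ MM] MT _] M1; apply: MT; apply/seteqP; split=> // x _.
by rewrite -[x]mulr1; exact: MM.
Qed.

(** A maximal left ideal missing [y] would contain some [1 - r * y], which is left invertible since
    [r * y] is nilpotent. *)
Lemma nil_multiples_jacobson y :
  (forall r, nilpotent (r * y)) -> jacobson R y.
Proof.
move=> nily M maxM; apply: contrapT => nMy.
have [r Mr] := maximal_left_ideal_linv maxM nMy.
apply: (maximal_left_ideal1 maxM).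
by case: maxM => idM _ _; exact: left_ideal1_nil (nily r) Mr.
Qed.

Lemma two_sided_idealX I a b n : two_sided_ideal I -> I (a - b) ->
  I (a ^+ n - b ^+ n).
Proof.
move=> [[I0 ID IM] IMr] Iab; elim: n => [|n IHn]; first by rewrite subrr.
have -> : a ^+ n.+1 - b ^+ n.+1 = a * (a ^+ n - b ^+ n) + (a - b) * b ^+ n.
  by rewrite !exprS mulrBr mulrBl addrA subrK.
by apply: ID; [exact: IM|exact: IMr].
Qed.

Lemma nilpotent_modulo I a b : nil_ideal I -> I (a - b) -> nilpotent b ->
  nilpotent a.
Proof.
move=> [idI nilI] Iab [n bn0]; have := two_sided_idealX n idI Iab.
rewrite bn0 subr0 => /nilI[m am0]; by exists (n * m)%N; rewrite exprM.
Qed.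

(** The set is the sum [I + K], described by congruence modulo [I]. *)
Lemma two_sided_idealD I K : two_sided_ideal I -> two_sided_ideal K ->
  two_sided_ideal [set x | exists2 k, K k & I (x - k)].
Proof.
move=> [[I0 ID IM] IMr] [[K0 KD KM] KMr]; split; first split.
- by exists 0 => //; rewrite subrr.
- move=> x y [k Kk Ix] [k' Kk' Iy]; exists (k + k'); first exact: KD.
  by rewrite opprD addrACA; exact: ID.
- by move=> a x [k Kk Ix]; exists (a * k); [exact: KM|rewrite -mulrBr; exact: IM].
- by move=> a x [k Kk Ix]; exists (k * a); [exact: KMr|rewrite -mulrBl; exact: IMr].
Qed.

Lemma nil_idealD I K : nil_ideal I -> nil_ideal K ->
  nil_ideal [set x | exists2 k, K k & I (x - k)].
Proof.
move=> nI [idK nilK]; split; first by case: nI => idI _; exact: two_sided_idealD.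
by move=> x [k Kk Ixk]; exact: nilpotent_modulo Ixk (nilK k Kk).
Qed.

Lemma nil_ideal0 : nil_ideal [set 0 : R].
Proof.
split; last by move=> x ->; exists 1%N.
by split; [split|] => // [x y -> ->|a x ->|a x ->]; rewrite ?addr0 ?mulr0 ?mul0r.
Qed.

Lemma nil_radical_nilpotent x : nil_radical R x -> nilpotent x.
Proof.
move=> [s [sI ->]].
suff [I [_ nilI] Is] : exists2 I : set R, nil_ideal I & I (\sum_(y <- s) y).
  exact: nilI.
elim: s sI => [|y s IHs] sI; first by exists [set 0] => //; [exact: nil_ideal0|rewrite big_nil].
have [|I nI Is] := IHs; first by move=> z zs; apply: sI; rewrite inE zs orbT.
have [|K nK Ky] := sI y; first by rewrite inE eqxx.
exists [set x | exists2 k, K k & I (x - k)]; first exact: nil_idealD.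
by exists y => //; rewrite big_cons addrC addKr.
Qed.

Lemma nil_radical_jacobson : nil_radical R `<=` jacobson R.
Proof.
move=> _ [s [sI ->]]; have [J0 JD _] := jacobson_left_ideal R.
rewrite big_seq; elim/big_ind: _ => // y /sI[I [[[_ _ IM] _] nilI] Iy].
by apply: nil_multiples_jacobson => r; apply: nilI; exact: IM.
Qed.

(** The nil radical always lies in the Jacobson radical, and a nil Jacobson radical is itself one of
    the ideals summed. *)
Lemma jacobson_nilP :
  jacobson R = nil_radical R <-> forall x, jacobson R x -> nilpotent x.
Proof.
split=> [-> x|nilJ]; first exact: nil_radical_nilpotent.
apply/seteqP; split; last exact: nil_radical_jacobson.
move=> x Jx; exists [:: x]; split; last by rewrite big_seq1.
move=> y; rewrite inE => /eqP->; exists (jacobson R) => //.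
by split=> //; exact: jacobson_two_sided.
Qed.

Lemma left_ideal_unit I x : left_ideal I -> units R x -> I x -> I 1.
Proof. by move=> [_ _ IM] [y [<- _]]; exact: IM. Qed.

Lemma units1 : units R 1.
Proof. by exists 1; rewrite mulr1. Qed.

Lemma unitsM x y : units R x -> units R y -> units R (x * y).
Proof.
move=> [x' [x'x xx']] [y' [y'y yy']]; exists (y' * x'); split.
  by rewrite mulrA -(mulrA y') x'x mulr1.
by rewrite mulrA -(mulrA x) yy' mulr1.
Qed.

End NilRadical.

(** * Local rings: the nonunits as radical *)

Section Local.
Local Open Scope ring_scope.
Local Open Scope classical_set_scope.
Variable R : nzRingType.

Lemma units0 : ~ units R 0.
Proof. by case=> y [/esym/eqP + _]; rewrite mulr0 oner_eq0. Qed.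

Lemma local_nonunits_maximal : local R -> maximal_left_ideal (~` units R).
Proof.
move=> [idN _]; split=> // [NT|K idK NK].
  have : (~` units R) 1 by rewrite NT.
  by apply; exact: units1.
have [KN|/existsNP[x /not_implyP[Kx /contrapT ux]]] := pselect (K `<=` ~` units R).
  by left; apply/seteqP; split.
right; apply/seteqP; split=> // y _; case: (idK) => _ _ KM.
by rewrite -[y]mulr1; apply: KM; exact: left_ideal_unit ux Kx.
Qed.

(** A maximal left ideal contains no unit, hence lies in the left ideal of nonunits and equals it:
    there is only one. *)
Lemma local_jacobson : local R -> jacobson R = ~` units R.
Proof.
move=> locR; have maxN := local_nonunits_maximal locR.
apply/seteqP; split=> [x|x nx M maxM]; first by apply.
have M1 := maximal_left_ideal1 maxM; have [idM _ maxlM] := maxM.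
have [] := maxlM _ _ _ : (~` units R) = M \/ _; rewrite ?maxN //.
- by case: maxN.
- by move=> y My uy; apply: M1; exact: left_ideal_unit uy My.
- by move=> <-.
- by case: maxN.
Qed.

Lemma local_nilP : local R ->
  jacobson R = nil_radical R <-> forall x, ~ units R x -> nilpotent x.
Proof. by move=> locR; rewrite jacobson_nilP local_jacobson. Qed.

End Local.

(** * Preimages under surjective ring morphisms *)

Section Preimage.
Local Open Scope ring_scope.
Local Open Scope classical_set_scope.
Variables (R : pzRingType) (T : nzRingType) (f : {rmorphism R -> T}).
Hypothesis f_surj : forall y, exists x, f x = y.

(** The element [e] belongs to the set and annihilates the kernel of [f], so left multiplication by
    [e] turns an identity valid in [T] into one valid in [R]. *)
Lemma units_preim_denominator e : f e = 1 ->
    (forall x, f x = 0 -> e * x = 0) ->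
  left_denominator_set [set x | units T (f x)].
Proof.
move=> fe1 ker_e; have Se : units T (f e) by rewrite fe1; exact: units1.
split; first split; rewrite /=.
- by rewrite rmorph1; exact: units1.
- by rewrite rmorph0; exact: units0.
- by move=> x y ux uy; rewrite rmorphM; exact: unitsM.
- move=> r s [v [vs _]]; have [u fu] := f_surj (f r * v).
  exists e, (e * u); split=> //; apply/eqP.
  rewrite -subr_eq0 -mulrA -mulrBr ker_e // rmorphB rmorphM fu -mulrA vs.
  by rewrite mulr1 subrr.
move=> r s [v [_ sv]] rs0; exists e => //; apply: ker_e.
by rewrite -[f r]mulr1 -sv mulrA -rmorphM rs0 rmorph0 mul0r.
Qed.

Lemma maximal_left_ideal_preim (M : set T) : maximal_left_ideal M ->
  maximal_left_ideal [set x | M (f x)].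
Proof.
move=> maxM; have [[M0 MD MM] _ maxlM] := maxM; split.
- split=> [|x y Mx My|a x Mx] /=; first by rewrite rmorph0.
    by rewrite rmorphD; exact: MD.
  by rewrite rmorphM; exact: MM.
- move=> MT; apply: (maximal_left_ideal1 maxM).
  by rewrite -(rmorph1 f); have : [set x | M (f x)] 1 by rewrite MT.
move=> K idK MK; have [K0 KD KM] := idK.
pose fK : set T := [set y | exists2 x, K x & f x = y].
have idfK : left_ideal fK.
  split; first by exists 0; rewrite ?rmorph0.
    by move=> _ _ [x Kx <-] [y Ky <-]; exists (x + y); [exact: KD|rewrite rmorphD].
  move=> a _ [x Kx <-]; have [b <-] := f_surj a.
  by exists (b * x); [exact: KM|rewrite rmorphM].
have [|KfM|KfT] := maxlM fK idfK.
- by move=> y; have [x <-] := f_surj y => Mx; exists x => //; exact: MK.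
- by left; apply/seteqP; split=> // x Kx; rewrite /= -KfM; exists x.
right; apply/seteqP; split=> // x _.
have [y Ky fyx] : fK (f x) by rewrite KfT.
rewrite -[x](subrK y); apply: KD => //; apply: MK.
by rewrite /= rmorphB fyx subrr.
Qed.

Lemma jacobson_rmorph x : jacobson R x -> jacobson T (f x).
Proof. by move=> Jx M /maximal_left_ideal_preim /Jx. Qed.

End Preimage.

(** * Local components obtained from left ideals minimal over the radical *)

Section LocalComponents.
Local Open Scope ring_scope.
Local Open Scope classical_set_scope.
Variable R : nzRingType.
Implicit Types (A B K L P S : set R) (e r s t x y : R).

Let J : set R := jacobson R.
Let idJ : two_sided_ideal J := jacobson_two_sided R.
Hypothesis nilJ : forall x, J x -> nilpotent x.

Lemma idempotent_moduloX e n : J (e - e * e) -> J (e - e ^+ n.+1).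
Proof.
have [[_ JD JM] _] := idJ; move=> Je; elim: n => [|n IHn].
  by rewrite expr1 subrr; have [[]] := idJ.
have -> : e - e ^+ n.+2 = (e - e * e) + e * (e - e ^+ n.+1).
  by rewrite mulrBr addrA subrK -exprS.
by apply: JD => //; exact: JM.
Qed.

Lemma left_ore_setX S s n : left_ore_set S -> S s -> S (s ^+ n).
Proof.
move=> [S1 _ SM _] Ss; elim: n => [|n IHn]; first by rewrite expr0.
by rewrite exprS; exact: SM.
Qed.

(** The Ore condition supplies one element of [S] that kills both summands, or that kills
    [a * x]. *)
Lemma left_denominator_ass S : left_denominator_set S ->
  two_sided_ideal [set r | exists2 t, S t & t * r = 0].
Proof.
move=> [[S1 _ SM ore] _]; split; first split.
- by exists 1 => //; rewrite mulr0.
- move=> x y [t St tx] [t' St' t'y].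
  have [t1 [u [St1 t1t]]] := ore t t' St'; exists (t1 * t); first exact: SM.
  by rewrite mulrDr -mulrA tx mulr0 t1t -mulrA t'y mulr0 addr0.
- move=> a x [t St tx]; have [t1 [u [St1 t1a]]] := ore a t St.
  by exists t1 => //; rewrite mulrA t1a -mulrA tx mulr0.
- by move=> a x [t St tx]; exists t => //; rewrite mulrA tx mul0r.
Qed.

(** Expresses inside [R] that [L / J] is a minimal left ideal of [R / J]. *)
Definition minimal_over_jacobson L : Prop :=
  [/\ left_ideal L, J `<=` L, ~ L `<=` J
    & forall K, left_ideal K -> J `<=` K -> K `<=` L -> K `<=` J \/ L `<=` K].

(** Brauer's lemma modulo [J]: right multiplication by a suitable [a] in [L] is bijective on the
    simple module [L / J], and [e] is the element that it sends to [a]. *)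
Lemma minimal_over_jacobson_idempotent L : minimal_over_jacobson L ->
  exists e, [/\ L e, ~ J e & forall x, L x -> J (x - x * e)].
Proof.
have [[J0 JD JM] JMr] := idJ; move=> [[L0 LD LM] JL nLJ minL].
(* Otherwise all squares [(r * x) ^+ 2] with [x] in [L] would lie in the nil ideal [J], forcing [L]
   into [J]. *)
have [a [b [La Lb nJba]]] : exists a b, [/\ L a, L b & ~ J (b * a)].
  apply: contrapT => LLJ; apply: nLJ => x Lx.
  apply: nil_multiples_jacobson => r.
  have [|n rxn] := @nilJ ((r * x) ^+ 2); last by exists (2 * n)%N; rewrite exprM.
  apply: contrapT => nJ; apply: LLJ; exists (r * x), (r * x).
  by split => //; exact: LM.
pose K : set R := [set z | exists2 y, L y & J (z - y * a)].
have [e Le Jae] : K a.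
  have [| | |KJ|] := minL K; last by apply.
  - split; first by exists 0; rewrite // mul0r subr0.
      move=> z z' [y Ly Jz] [y' Ly' Jz']; exists (y + y'); first exact: LD.
      by rewrite mulrDl opprD addrACA; exact: JD.
    move=> c z [y Ly Jz]; exists (c * y); first exact: LM.
    by rewrite -mulrA -mulrBr; exact: JM.
  - by move=> z Jz; exists 0; rewrite // mul0r subr0.
  - move=> z [y Ly Jz]; rewrite -[z](subrK (y * a)).
    by apply: LD; [exact: JL|exact: LM].
  by case: nJba; apply: KJ; exists b; rewrite // subrr.
(* The kernel of multiplication by [a] modulo [J]; it will contain [x - x * e], since
   [(x - x * e) * a = x * (a - e * a)]. *)
pose N : set R := [set y | L y /\ J (y * a)].
have NJ : N `<=` J.
  have [| | |//|LN] := minL N.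
  - split; first by rewrite /N /= mul0r.
      by move=> y z [Ly Jy] [Lz Jz]; split; [exact: LD|rewrite mulrDl; exact: JD].
    by move=> c y [Ly Jy]; split; [exact: LM|rewrite -mulrA; exact: JM].
  - by move=> y Jy; split; [exact: JL|exact: JMr].
  - by move=> y [].
  by have [] := LN b Lb.
exists e; split=> // [Je|x Lx].
  apply: nJba; apply: JM; rewrite -[a](subrK (e * a)).
  by apply: JD => //; exact: JMr.
apply: NJ; split.
  apply: LD => //; rewrite -mulN1r; apply: (LM); exact: LM.
by rewrite mulrBl -mulrA -mulrBr; exact: JM.
Qed.

(* These conditions make [R / A] a local ring with maximal ideal [P / A]; the
   last one makes [A] vanish in the localization away from [P]. *)
Definition local_component A P : Prop :=
  [/\ two_sided_ideal A, P = [set x | exists2 a, A a & J (x - a)], ~ P 1,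
      (forall r, ~ P r -> exists x, P (1 - x * r))
    & forall a, A a -> exists2 t, ~ P t & t * a = 0].

Lemma minimal_over_jacobson_component L : weakly_left_localizable R ->
    minimal_over_jacobson L ->
  exists A P, local_component A P /\ forall y p, L y -> P p -> J (y * p).
Proof.
have [[J0 JD JM] JMr] := idJ; have JB x y : J x -> J y -> J (x - y).
  by case: idJ => lJ _; exact: left_idealB.
move=> wll minL; have [[L0 LD LM] JL nLJ minlL] := minL.
have [e [Le nJe JLe]] := minimal_over_jacobson_idempotent minL.
have Jee : J (e - e * e) by exact: JLe.
have [|S denS Se] := wll e.
  move=> [n en0]; apply: nJe.
  by have := idempotent_moduloX n Jee; rewrite exprS en0 mulr0 subr0.
have [oreS revS] := denS; have [S1 nS0 SM _] := oreS.
pose A : set R := [set r | exists2 t, S t & t * r = 0].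
pose P : set R := [set x | exists2 a, A a & J (x - a)].
have idA : two_sided_ideal A by exact: left_denominator_ass.
have idP : two_sided_ideal P by exact: two_sided_idealD.
have [[P0 PD PM] PMr] := idP.
have JP : J `<=` P.
  by move=> x Jx; exists 0; rewrite ?subr0 //; case: idA => -[].
(* If [s] is congruent to [a] modulo [J] and [t * a = 0], then [t * s] is in [J], hence nilpotent,
   although its powers stay in [S]. *)
have SP s : S s -> ~ P s.
  move=> Ss [a [t St ta] Jsa]; have := JM t _ Jsa.
  rewrite mulrBr ta subr0 => /nilJ[n tsn0]; apply: nS0.
  by rewrite -tsn0; apply: left_ore_setX => //; exact: SM.
have P1 : ~ P 1 by exact: SP.
(* The factors commute, so [(1 - e) ^+ n.+1 * e ^+ n = (1 - e) * (e - e * e) ^+ n = 0], and the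
   denominator condition puts [(1 - e) ^+ n.+1] in [A]. *)
have P1e : P (1 - e).
  have J1e : J ((1 - e) - (1 - e) * (1 - e)).
    by rewrite mulrBr mulr1 opprB addrC subrK mulrBl mul1r.
  have [n en0] := nilJ Jee.
  exists ((1 - e) ^+ n.+1); last exact: idempotent_moduloX.
  apply: (@revS _ (e ^+ n)); first exact: left_ore_setX.
  rewrite exprS -mulrA -exprMn_comm; first by rewrite [(1 - e) * e]mulrBl mul1r en0 mulr0.
  by apply: commr_sym; apply: commrB; [exact: commr1|].
exists A, P; split; first split=> //.
(* Modulo [P], [r] is [r * e]; minimality of [L] makes [e], itself [1] modulo [P], a left multiple
   of [r * e] modulo [J]. *)
- move=> r nPr.
  have rE : r = r * e + r * (1 - e) by rewrite -mulrDr addrC subrK mulr1.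
  have nJre : ~ J (r * e).
    by move=> Jre; apply: nPr; rewrite rE; apply: PD; [exact: JP|exact: PM].
  pose K : set R := [set z | exists x, J (z - x * (r * e))].
  have [x Jx] : K e.
    have [| | |KJ|] := minlL K; last by apply.
    + split; first by exists 0; rewrite mul0r subr0.
        move=> z z' [y Jz] [y' Jz']; exists (y + y').
        by rewrite mulrDl opprD addrACA; exact: JD.
      move=> c z [y Jz]; exists (c * y).
      by rewrite -mulrA -mulrBr; exact: JM.
    + by move=> z Jz; exists 0; rewrite mul0r subr0.
    + move=> z [y Jz]; rewrite -[z](subrK (y * (r * e))).
      by apply: LD; [exact: JL|do 2!apply: (LM)].
    by case: nJre; apply: KJ; exists 1; rewrite mul1r subrr.
  exists x; have -> : 1 - x * r =
      (1 - e) + ((e - x * (r * e)) + - x * (r * (1 - e))).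
    rewrite [in x * r]rE mulrDr opprD mulNr -[RHS]addrA ?addrA.
    by rewrite subrK.
  by apply: (PD) => //; apply: PD; [exact: JP|do 2!apply: (PM)].
- by move=> a [t St ta]; exists t => //; exact: SP.
(* By minimality [P] meets [L] inside [J] or contains [e]; the latter would put [1] in [P]. *)
have PLJ z : P z -> L z -> J z.
  have [| | |PL Pz Lz|LPL] := minlL [set z | P z /\ L z].
  - split=> //; first by move=> x y [Px Lx] [Py Ly]; split; [exact: PD|exact: LD].
    by move=> a x [Px Lx]; split; [exact: PM|exact: LM].
  - by move=> x Jx; split; [exact: JP|exact: JL].
  - by move=> x [].
  - exact: PL.
  have [Pe _] := LPL e Le; case: P1; rewrite -[1](subrK e); exact: PD.
(* [y * p] may leave the left ideal [L], but the square of [r * (y * p)] has the inner factor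
   [p * (r * y)], which lies in both [P] and [L]. *)
move=> y p Ly Pp; apply: nil_multiples_jacobson => r.
have [|n ypn] := @nilJ ((r * (y * p)) ^+ 2); last by exists (2 * n)%N; rewrite exprM.
have -> : (r * (y * p)) ^+ 2 = r * y * (p * (r * y)) * p.
  by rewrite expr2 !mulrA.
apply: JMr; apply: JM; apply: PLJ; first exact: PMr.
by do 2!apply: (LM).
Qed.

(** The decomposition of [1] in the semisimple ring [R / J] lifts through representatives; minimal
    left ideals pull back to left ideals minimal over [J]. *)
Lemma semilocal_minimal_over : semilocal R -> exists s : seq R,
  (forall y, y \in s -> exists2 L, minimal_over_jacobson L & L y) /\
  J (1 - \sum_(y <- s) y).
Proof.
move=> ssR; pose pi : R -> ideal_quot idJ := quot_pi idJ.
have piD x y : pi (x + y) = pi x + pi y by exact: quot_piD.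
have piM x y : pi (x * y) = pi x * pi y by exact: quot_piM.
have pi_eq x y : pi x = pi y <-> J (x - y) by exact: quot_piP.
have pi0 : pi 0 = 0 by apply: (addrI (pi 0)); rewrite -piD !addr0.
have pi0P x : pi x = 0 <-> J x by rewrite -pi0 pi_eq subr0.
have [s [sL sum1]] : ideal_sum (@minimal_left_ideal (ideal_quot idJ)) 1.
  by rewrite ssR.
exists [seq quot_repr q | q <- s]; split; last first.
  apply/pi_eq; rewrite -[pi 1]/(1 : ideal_quot idJ) sum1 big_map.
  elim: {sL sum1} s => [|q s IHs]; first by rewrite !big_nil pi0.
  by rewrite !big_cons piD -IHs /pi quot_reprK.
move=> _ /mapP[q qs ->]; have [L [[L0 LD LM] nL0 minL] Lq] := sL q qs.
exists [set x | L (pi x)]; last by rewrite /= /pi quot_reprK.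
split.
- split=> [|x y Lx Ly|a x Lx] /=; first by rewrite pi0.
    by rewrite piD; exact: LD.
  by rewrite piM; exact: LM.
- by move=> x /pi0P; rewrite /= => ->.
- move=> LJ; apply: nL0; apply/seteqP; split=> [p|_ ->] //=.
  by rewrite -[p]quot_reprK => /LJ/pi0P.
move=> K [K0 KD KM] JK KL; pose piK := [set p | exists2 x, K x & pi x = p].
have [| |pK0|pKL] := minL piK.
- split; first by exists 0.
    by move=> _ _ [x Kx <-] [y Ky <-]; exists (x + y); [exact: KD|rewrite piD].
  move=> a _ [x Kx <-]; exists (quot_repr a * x); first exact: KM.
  by rewrite piM /pi quot_reprK.
- by move=> _ [x Kx <-]; exact: KL.
- by left=> x Kx; apply/pi0P; have : piK (pi x) by [exists x]; rewrite pK0.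
right=> x /=; rewrite -pKL => -[y Ky /esym/pi_eq Jxy].
by rewrite -[x](subrK y); apply: KD => //; exact: JK.
Qed.

(* The last clause stands for "[F] contains every maximal left ideal"; in this
   form it needs no maximal left ideal above [B], hence no Zorn's lemma. *)
Lemma local_components_family : semilocal R -> weakly_left_localizable R ->
  exists F : seq (set R),
    [/\ uniq F, forall P, P \in F -> exists A, local_component A P
      & forall B, left_ideal B ->
          (forall P, P \in F -> exists2 t, B t & ~ P t) -> B 1].
Proof.
move=> /semilocal_minimal_over[s [sL J1s]] wll.
have /choice[P sP] : forall y, exists P, y \in s ->
    (exists A, local_component A P) /\ forall p, P p -> J (y * p).
  move=> y; have [ys|] := boolP (y \in s); last by exists set0.
  have [L minL Ly] := sL y ys.
  have [A [P [AP LPJ]]] := minimal_over_jacobson_component wll minL.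
  by exists P => _; split; [exists A|move=> p; exact: LPJ].
(* Different summands may share the same [P]; comaximality later requires distinct ones. *)
exists (undup (map P s)); split; first exact: undup_uniq.
  by move=> Q; rewrite mem_undup => /mapP[y /sP[? _] ->].
move=> B idB BF; have [[J0 JD JM] JMr] := idJ; have [B0 BD BM] := idB.
(* Since [t] has a left inverse [x] modulo [P y], the difference [y - y * (x * t)] lies in
   [y * P y], hence in [J]. *)
have BJ y : y \in s -> exists2 b, B b & J (y - b).
  move=> ys; have [[A [_ _ _ maxP _]] yPJ] := sP y ys.
  have [|t Bt nPt] := BF (P y); first by rewrite mem_undup; apply/mapP; exists y.
  have [x P1xt] := maxP t nPt; exists (y * (x * t)); first by do 2!apply: (BM).
  by rewrite -{1}[y]mulr1 -mulrBr; exact: yPJ.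
have [b Bb Jsb] : exists2 b, B b & J (\sum_(y <- s) y - b).
  rewrite big_seq; elim/big_ind: _ => [|x y [b Bb Jx] [c Bc Jy]|y ys].
  - by exists 0; rewrite ?subrr.
  - by exists (b + c); [exact: BD|rewrite opprD addrACA; exact: JD].
  - exact: BJ.
apply: (left_ideal1_nil (x := 1 - b)) => //; last by rewrite opprB addrC subrK.
apply: nilJ; rewrite -[1](subrK (\sum_(y <- s) y)) -addrA; exact: JD.
Qed.

(** For [r] in [P'] outside [P], writing [1 = (1 - x * r) + x * r] puts [1] in [P + P'], hence in
    [A + A'] up to a nilpotent element of [J]. *)
Lemma local_component_comaximal A P A' P' : local_component A P ->
  local_component A' P' -> P <> P' -> exists2 b, A' b & A (1 - b).
Proof.
wlog [r P'r nPr] : A P A' P' / exists2 r, P' r & ~ P r.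
  move=> IH cA cA' PP'.
  have [P'P|/existsNP[r /not_implyP[P'r nPr]]] := pselect (P' `<=` P); last first.
    by apply: IH cA cA' PP'; exists r.
  have [PP|/existsNP[r /not_implyP[Pr nP'r]]] := pselect (P `<=` P').
    by case: PP'; apply/seteqP; split.
  (* Here [P] is not contained in [P']: the roles are exchanged and [1 - b] replaces [b]. *)
  have [||b Ab A'b] := IH _ _ _ _ _ cA' cA; first by exists r.
    by move=> /esym.
  by exists (1 - b) => //; rewrite subKr.
move=> [idA PE _ maxP _] [idA' PE' _ _ _] _; have [x] := maxP r nPr.
rewrite {1}PE => -[a Aa Ja].
have [[_ _ P'M] _] : two_sided_ideal P' by rewrite PE'; exact: two_sided_idealD.
have := P'M x r P'r; rewrite PE' => -[b A'b Jb].
have idAA' := two_sided_idealD idA idA'; have [lAA' _] := idAA'.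
have [[_ JD _] _] := idJ.
apply: (left_ideal1_nil lAA' (nilJ (JD _ _ Ja Jb))); exists b => //.
have -> : 1 - (1 - x * r - a + (x * r - b)) - b = a; last by [].
rewrite (addrAC 1 (- (x * r))) addrA subrK opprB addrA.
by rewrite [1 + b - _]addrAC addrK subKr.
Qed.

(** The units of [T] are the images of elements outside [P]: such an image has a left inverse of the
    same kind, which is therefore two-sided. Elements of [P] are congruent modulo [A] to elements of
    [J], so their images are nilpotent. *)
Lemma local_component_quotient A P (T : nzRingType) (f : {rmorphism R -> T}) :
    local_component A P -> (forall y : T, exists x, f x = y) ->
    (forall x, f x = 0 <-> A x) ->
  local T /\ jacobson T = nil_radical T.
Proof.
move=> [idA PE P1 maxP _] f_surj kerf.
have idP : two_sided_ideal P by rewrite PE; exact: two_sided_idealD.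
have [[P0 PD PM] PMr] := idP.
have AP x : A x -> P x.
  by rewrite PE; exists x; rewrite // subrr; case: idJ => -[].
have inv1 x y : f x * f y = 1 -> A (1 - x * y).
  by move=> fxy; apply/kerf; rewrite rmorphB rmorphM fxy rmorph1 subrr.
have linv x : ~ P x -> exists2 w, ~ P w & f w * f x = 1.
  move=> /maxP[z]; rewrite {1}PE => -[a /kerf fa Jza].
  have [u u1] := subr1_nilpotent_linv (nilJ Jza).
  rewrite -[1 - z * x - a]addrA -opprD subKr in u1.
  have uzx : f (u * z) * f x = 1.
    rewrite -rmorphM -mulrA -[LHS]addr0 -(mulr0 (f u)) -fa.
    by rewrite -rmorphM -rmorphD -mulrDr u1 rmorph1.
  exists (u * z) => // Puz; apply: P1; rewrite -[1](subrK (u * z * x)).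
  by apply: PD; [apply: AP; exact: inv1|exact: PMr].
have unitP x : units T (f x) <-> ~ P x.
  split=> [[y [yx _]]|/linv[w /linv[v _ vw] wx]].
    have [z zy] := f_surj y; rewrite -zy in yx => Px.
    apply: P1; rewrite -[1](subrK (z * x)).
    by apply: PD; [apply: AP; exact: inv1|exact: PM].
  exists (f w); split=> //.
  by rewrite -[f x]mul1r -vw -[f v * _ * _]mulrA wx mulr1.
have NE (y : T) : (~` units T) y -> exists2 x, P x & f x = y.
  by have [x <-] := f_surj y => nu; exists x => //; apply: contrapT => /unitP.
have EN x : P x -> (~` units T) (f x) by move=> Px /unitP.
have locT : local T.
  split; first split.
  - by rewrite -(rmorph0 f); exact: EN.
  - by move=> _ _ /NE[x Px <-] /NE[y Py <-]; rewrite -rmorphD; apply: EN; exact: PD.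
  - move=> a _ /NE[x Px <-]; have [b <-] := f_surj a.
    by rewrite -rmorphM; apply: EN; exact: PM.
  - move=> a _ /NE[x Px <-]; have [b <-] := f_surj a.
    by rewrite -rmorphM; apply: EN; exact: PMr.
split=> //; apply/local_nilP => // y /NE[x Px <-].
move: Px; rewrite PE => -[a /kerf fa /nilJ[n xan]]; exists n.
by rewrite -[f x]subr0 -fa -rmorphB -rmorphXn xan rmorph0.
Qed.

End LocalComponents.

(** * Proper quotients and the Chinese remainder theorem *)

Lemma ideal_quot_nzRing (R : pzRingType) (A : set R) :
    two_sided_ideal A -> ~ A 1%R ->
  exists (T : nzRingType) (f : {rmorphism R -> T}),
    (forall y, exists x, f x = y) /\ forall x, f x = 0%R <-> A x.
Proof.
move=> idA A1; pose pi : R -> ideal_quot idA := quot_pi idA.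
have pi0 : pi 0%R = 0%R.
  by apply: (addrI (pi 0%R)); rewrite -[LHS]quot_piD !addr0.
have pi_eq0 x : pi x = 0%R <-> A x by rewrite -pi0 [pi _ = _]quot_piP subr0.
have nz : (1 : ideal_quot idA)%R != 0%R.
  by apply/eqP => /pi_eq0.
pose nzM := GRing.PzSemiRing_isNonZero.Build (ideal_quot idA) nz.
pose T : nzRingType := HB.pack (ideal_quot idA) nzM.
have piB : GRing.zmod_morphism (pi : R -> T).
  by move=> x y; apply/eqP; rewrite eq_sym subr_eq -[eqbRHS]quot_piD subrK.
have piM : GRing.monoid_morphism (pi : R -> T).
  by split=> // x y; exact: quot_piM.
pose f : {rmorphism R -> T} := HB.pack (pi : R -> T)
  (GRing.isZmodMorphism.Build _ _ _ piB) (GRing.isMonoidMorphism.Build _ _ _ piM).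
exists T, f; split=> // y; exists (quot_repr y); exact: quot_reprK.
Qed.

Section ProductMorphism.
Local Open Scope ring_scope.
Variables (R : pzRingType) (n : nat) (T : 'I_n -> nzRingType).

Lemma prod_exprE (x : prod_ring T) k i : (x ^+ k) i = x i ^+ k.
Proof.
elim: k => [|k IHk] //.
by rewrite !exprS -IHk.
Qed.

(** For fixed [i], the product of the pairwise elements is a [c i] with image [1] at [i] and [0]
    elsewhere; these glue chosen lifts together. *)
Lemma chinese_remainder (f : forall i, {rmorphism R -> T i}) :
    (forall i y, exists x, f i x = y) ->
    (forall i j, i != j -> exists2 b, f j b = 0 & f i b = 1) ->
    (forall x, (forall i, f i x = 0) -> x = 0) ->
  ring_isomorphic R (prod_ring T).
Proof.
move=> f_surj f_comax f_inj.
have /choice[c cP] i : exists c, f i c = 1 /\ forall j, j != i -> f j c = 0.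
  suff [c [ci cj]] : exists c, f i c = 1 /\
      forall j, j \in enum 'I_n -> j != i -> f j c = 0.
    by exists c; split=> // j; apply: cj; rewrite mem_enum.
  elim: (enum 'I_n) => [|j s [c [ci cs]]]; first by exists 1; rewrite rmorph1.
  have [eij|ij] := eqVneq i j.
    subst j; exists c; split=> // k; rewrite inE => /predU1P[-> /eqP //|]; exact: cs.
  have [b bj bi] := f_comax i j ij.
  exists (b * c); split=> [|k]; first by rewrite rmorphM bi ci mulr1.
  rewrite rmorphM inE => /predU1P[-> _|ks /(cs k ks)->]; last by rewrite mulr0.
  by rewrite bj mul0r.
pose g (x : R) : prod_ring T := fun i => f i x.
have gB : GRing.zmod_morphism g.
  by move=> x y; apply: functional_extensionality_dep => i; exact: rmorphB.
have gM : GRing.monoid_morphism g.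
  split=> [|x y]; apply: functional_extensionality_dep => i; first exact: rmorph1.
  exact: rmorphM.
pose h : {rmorphism R -> prod_ring T} := HB.pack g
  (GRing.isZmodMorphism.Build _ _ _ gB) (GRing.isMonoidMorphism.Build _ _ _ gM).
have h_inj : injective h.
  move=> x y hxy; apply/eqP; rewrite -subr_eq0; apply/eqP/f_inj => i.
  by rewrite rmorphB; apply/eqP; rewrite subr_eq0; apply/eqP/(congr1 (@^~ i) hxy).
have h_surj (y : prod_ring T) : exists x, h x = y.
  pose z i := projT1 (cid (f_surj i (y i))).
  have zP i : f i (z i) = y i by rewrite /z; case: cid.
  exists (\sum_i z i * c i); apply: functional_extensionality_dep => i.
  rewrite /h /= /g rmorph_sum (bigD1 i) //= big1 => [|j ji].
    by rewrite addr0 rmorphM zP (cP i).1 mulr1.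
  by rewrite rmorphM (cP j).2 ?mulr0 // eq_sym.
have [k kP] := choice h_surj.
by exists h, k => // x; apply: h_inj; rewrite kP.
Qed.

End ProductMorphism.

(** * Finite products of local rings with nil radical *)

Section Converse.
Local Open Scope ring_scope.
Local Open Scope classical_set_scope.
Variables (R : nzRingType) (n : nat) (T : 'I_n -> nzRingType).
Variable f : {rmorphism R -> prod_ring T}.
Hypotheses (f_bij : bijective f) (locT : forall i, local (T i)).
Hypothesis nilT : forall i, jacobson (T i) = nil_radical (T i).

Lemma nilpotent_all_nonunits x : (forall i, ~ units (T i) (f x i)) ->
  nilpotent x.
Proof.
move=> nux.
have /choice[m mP] i : exists k, f x i ^+ k = 0.
  by move: (nux i); apply: (local_nilP (locT i)).1.
(* The sum of the exponents is at least each [m i], so this power kills every component. *)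
exists (\sum_i m i)%N; apply: (bij_inj f_bij); rewrite rmorphXn rmorph0.
apply: functional_extensionality_dep => i; rewrite prod_exprE.
by rewrite (bigD1 i) //= exprD mP mul0r.
Qed.

Definition prod_comp i (x : R) : T i := f x i.

Fact prod_comp_zmod_morphism i : GRing.zmod_morphism (prod_comp i).
Proof. by move=> x y; rewrite /prod_comp rmorphB. Qed.

Fact prod_comp_monoid_morphism i : GRing.monoid_morphism (prod_comp i).
Proof. by split=> [|x y]; rewrite /prod_comp ?rmorph1 ?rmorphM. Qed.

HB.instance Definition _ i := GRing.isZmodMorphism.Build _ _ _ (prod_comp_zmod_morphism i).
HB.instance Definition _ i := GRing.isMonoidMorphism.Build _ _ _ (prod_comp_monoid_morphism i).

(** Yields the surjectivity of each component and, for [y = 1], the multiplier annihilating the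
    kernel of the [i]-th one. *)
Lemma prod_comp_lift i (y : T i) : exists x, prod_comp i x = y /\
  forall j, j != i -> prod_comp j x = 0.
Proof.
have [g _ fK] := f_bij.
exists (g (dfwith (fun j => 0 : T j) y)); rewrite /prod_comp fK.
by split=> [|j ji]; rewrite ?fK ?dfwith_in // dfwith_out // eq_sym.
Qed.

Lemma prod_local_weakly_left_localizable : weakly_left_localizable R.
Proof.
move=> x nx; have [i ui] : exists i, units (T i) (f x i).
  by apply: contrapT => nu; apply/nx/nilpotent_all_nonunits => i ui; apply: nu; exists i.
exists [set y | units (T i) (prod_comp i y)] => //.
have [e [ei ej]] := prod_comp_lift (1 : T i).
apply: (@units_preim_denominator R (T i) (prod_comp i) _ e) => //.
  by move=> y; have [z [zy _]] := prod_comp_lift y; exists z.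
move=> y yi0; apply: (bij_inj f_bij); rewrite rmorph0.
apply: functional_extensionality_dep => j; rewrite -[f _ j]/(prod_comp j (e * y)) rmorphM /=.
have [->|ji] := eqVneq j i; first by rewrite yi0 mulr0.
by rewrite ej // mul0r.
Qed.

Lemma prod_local_jacobson : jacobson R = nil_radical R.
Proof.
apply/jacobson_nilP => x Jx; apply: nilpotent_all_nonunits => i.
suff : jacobson (T i) (prod_comp i x) by rewrite local_jacobson.
apply: jacobson_rmorph Jx => y; have [z [zy _]] := prod_comp_lift y; by exists z.
Qed.

End Converse.

(** * Assembly of the decomposition *)

Section Decomposition.
Local Open Scope ring_scope.
Local Open Scope classical_set_scope.

Lemma semilocal_prod_local (R : nzRingType) :
    semilocal R -> weakly_left_localizable R -> jacobson R = nil_radical R ->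
  exists (s : nat) (R_ : 'I_s -> nzRingType),
    [/\ (1 <= s)%N,
        (forall i, local (R_ i) /\ jacobson (R_ i) = nil_radical (R_ i))
      & ring_isomorphic R (prod_ring R_)].
Proof.
move=> semilocalR wll /jacobson_nilP nilJ.
have [F [uF FA F1]] := local_components_family nilJ semilocalR wll.
have nthF (i : 'I_(size F)) : nth set0 F i \in F by exact: mem_nth.
have /choice[A AP] i := FA _ (nthF i).
(* The dependent pair lets one choice select the ring together with its projection. *)
have /choice[c cP] : forall i, exists c : {T : nzRingType & {rmorphism R -> T}},
    (forall y, exists x, projT2 c x = y) /\
    forall x, projT2 c x = 0 <-> A i x.
  move=> i; have [idA PE P1 _ _] := AP i.
  have [|T [f fP]] := ideal_quot_nzRing idA; last by exists (existT _ T f).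
  move=> A1; apply: P1; rewrite PE; exists 1; rewrite // subrr.
  by have [[]] := jacobson_two_sided R.
exists (size F), (fun i => projT1 (c i)); split.
(* For empty [F], the zero ideal would satisfy the premise of [F1] and contain [1]. *)
- rewrite lt0n size_eq0; apply/eqP => F0.
  have /eqP : [set 0] (1 : R).
    by apply: F1; rewrite ?F0 //; case: (nil_ideal0 R) => -[].
  by rewrite oner_eq0.
- by move=> i; have [fs fA] := cP i; exact: local_component_quotient (AP i) fs fA.
apply: (chinese_remainder (f := fun i => projT2 (c i))).
- by move=> i; have [] := cP i.
- move=> i j ij; have PP : nth set0 F i <> nth set0 F j.
    by move/eqP; rewrite nth_uniq // => /eqP/val_inj/eqP; exact/negP.
  have [b Ab A1b] := local_component_comaximal nilJ (AP i) (AP j) PP.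
  exists b; first by apply/(cP j).2.
  apply/esym/eqP; rewrite -subr_eq0 -(rmorph1 (projT2 (c i))) -rmorphB.
  by apply/eqP/(cP i).2.
move=> x x0; rewrite -[x]mul1r.
apply: (F1 [set r | r * x = 0]).
  split=> [|r r' rx r'x|a r rx] /=; first by rewrite mul0r.
    by rewrite mulrDl rx r'x addr0.
  by rewrite -mulrA rx mulr0.
move=> P PF; have iP : (index P F < size F)%N by rewrite index_mem.
have [_ _ _ _ annA] := AP (Ordinal iP).
have [|t nPt tx] := annA x; first by apply/(cP _).2; exact: x0.
by exists t => //; move: nPt; rewrite nth_index.
Qed.

End Decomposition.

Unset Implicit Arguments.

Theorem theorem5p1 (R : nzRingType) (semilocalR : semilocal R) :
  (weakly_left_localizable R /\ jacobson R = nil_radical R) <->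
  (exists (s : nat) (R_ : 'I_s -> nzRingType),
     [/\ (1 <= s)%N,
         (forall i : 'I_s, local (R_ i) /\ jacobson (R_ i) = nil_radical (R_ i))
       & ring_isomorphic R (prod_ring R_)]).
Proof.
split=> [[wll radR]|[s [T [_ locT [f f_bij]]]]].
  exact: semilocal_prod_local.
have locT1 i := (locT i).1; have locT2 i := (locT i).2.
split; first exact: prod_local_weakly_left_localizable f_bij locT1 locT2.
exact: prod_local_jacobson f_bij locT1 locT2.
Qed.
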